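(* For $n \ge 2$, let $\tau(P_2 \square P_n)$ denote the number of minimum dominating sets of $P_2 \square P_n$. Then $\tau(P_2 \square P_n) = 6$ if $n=2$; $3$ if $n=3$; $17$ if $n=6$; $2$ if $n$ is odd and $n \ne 3$; and $2n+4$ if $n$ is even and $n \ne 2, 6$.
   Context: $P_2 \square P_n$ is the Cartesian product of the path on 2 vertices with the path on $n$ vertices. A dominating set of a graph $G$ is a set $D\subseteq V(G)$ such that every vertex not in $D$ is adjacent to a vertex of $D$; a minimum dominating set ($\gamma(G)$-set) is a dominating set of minimum cardinality. $\tau(G)$ is the total number of $\gamma(G)$-sets. *)

(* Defs.v *)
From mathcomp Require Import all_boot.

Set Implicit Arguments.
Unset Strict Implicit.
Unset Printing Implicit Defensive.

(* A finite simple graph is given by its adjacency relation, a symmetric      *)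
(* irreflexive relation on a finite vertex type.                              *)

Definition path_graph (n : nat) : rel 'I_n :=
  fun i j => (i.+1 == j :> nat) || (j.+1 == i :> nat).

Definition cart_prod (T U : finType) (e : rel T) (f : rel U) : rel (T * U) :=
  fun x y => (x.1 == y.1) && f x.2 y.2 || (x.2 == y.2) && e x.1 y.1.

Definition dominating (T : finType) (e : rel T) (D : {set T}) : bool :=
  [forall v, (v \notin D) ==> [exists u in D, e v u]].

Definition min_dominating (T : finType) (e : rel T) (D : {set T}) : bool :=
  dominating e D && [forall D' : {set T}, dominating e D' ==> (#|D| <= #|D'|)].

Definition tau (T : finType) (e : rel T) : nat :=
  #|[set D : {set T} | min_dominating e D]|.

Lemma path_graph_sym n : symmetric (@path_graph n).
Proof. by move=> i j; rewrite /path_graph orbC. Qed.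

Lemma path_graph_irrefl n : irreflexive (@path_graph n).
Proof. by move=> i; rewrite /path_graph orbb gtn_eqF. Qed.

Lemma cart_prod_sym (T U : finType) (e : rel T) (f : rel U) :
  symmetric e -> symmetric f -> symmetric (cart_prod e f).
Proof.
move=> se sf x y.
by rewrite /cart_prod se sf (eq_sym x.1) (eq_sym x.2).
Qed.

Lemma cart_prod_irrefl (T U : finType) (e : rel T) (f : rel U) :
  irreflexive e -> irreflexive f -> irreflexive (cart_prod e f).
Proof. by move=> ie i_f x; rewrite /cart_prod ie i_f !andbF. Qed.

(* Main.v *)
(** Scanning the ladder column by column, a vertex set is dominating exactly when
    its word of columns is accepted by an automaton whose state is the last
    column together with those of its vertices that are not yet dominated.
    Counting accepted words of length [n] by weight gives a linear recurrence on
    five states (up to exchanging the two rows).  The number of vertices a state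
    still requires is about [n/2], and at or just above that threshold the counts
    are constant or linear in [n] as soon as [n >= 8]; these closed forms follow
    by induction in steps of two columns. *)

Require Import Defs.
From mathcomp Require Import all_boot zify.

(** * The column automaton and its counting function *)

(* A column is the pair of membership bits of its two vertices. *)
Definition weight (c : bool * bool) : nat := c.1 + c.2.

(** A marked vertex has only one neighbour still to be read, the one in its row of the next column
    [c], so [c] must contain it. *)
Definition covers (c u : bool * bool) : bool := (u.1 ==> c.1) && (u.2 ==> c.2).

Definition missed (p c : bool * bool) : bool * bool :=
  (~~ [|| c.1, c.2 | p.1], ~~ [|| c.1, c.2 | p.2]).

(* [p] is the column before [s] and [u] marks its vertices not dominated so far. *)
Fixpoint good (p u : bool * bool) (s : seq (bool * bool)) : bool :=
  if s is c :: s' then covers c u && good c (missed p c) s'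
  else u == (false, false).

(** Words of length [n] and weight [k] accepted from state [(p, u)], counted recursively so that
    short cases compute; the test on [k] guards truncated subtraction. *)
Fixpoint cnt (n k : nat) (p u : bool * bool) : nat :=
  if n is n'.+1 then
    sumn [seq if covers c u && (weight c <= k)
              then cnt n' (k - weight c) c (missed p c) else 0
         | c <- [:: (false, false); (true, false); (false, true); (true, true)]]
  else (u == (false, false)) && (k == 0).

Lemma card_tupleS {T : finType} {n : nat} (P : pred (seq T)) :
  #|[set t : n.+1.-tuple T | P t]|
  = \sum_(c : T) #|[set t : n.-tuple T | P (c :: t)]|.
Proof.
rewrite -sum1_card (eq_bigl (fun t : n.+1.-tuple T => P t)); last first.
  by move=> t; rewrite inE.
rewrite (reindex (fun x : T * n.-tuple T => [tuple of x.1 :: x.2])) /=; last first.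
  exists (fun t : n.+1.-tuple T => (thead t, [tuple of behead t])) => [[c t] _|t _] /=.
    by rewrite theadE; congr (_, _); apply: val_inj.
  by rewrite -tuple_eta.
rewrite -(pair_big_dep xpredT (fun c (t : n.-tuple T) => P (c :: t)) (fun _ _ => 1)) /=.
apply: eq_bigr => c _; rewrite sum1dep_card.
by apply: eq_card => t; rewrite !inE.
Qed.

Lemma card_good (n k : nat) (p u : bool * bool) :
  #|[set t : n.-tuple (bool * bool) | good p u t && (\sum_(c <- t) weight c == k)]|
  = cnt n k p u.
Proof.
elim: n k p u => [|n IHn] k p u.
  have -> : [set t : 0.-tuple (bool * bool) | good p u t && (\sum_(c <- t) weight c == k)]
          = if (u == (false, false)) && (k == 0) then setT else set0.
    by apply/setP => t; rewrite inE (tuple0 t) /= big_nil (eq_sym 0); case: ifP; rewrite inE.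
  by rewrite /=; case: ifP; rewrite ?cardsT ?card_tuple ?cards0.
rewrite (card_tupleS (fun s => good p u s && (\sum_(c <- s) weight c == k))) /=.
have step c : #|[set t : n.-tuple (bool * bool) | covers c u && good c (missed p c) t
      && (\sum_(d <- c :: t) weight d == k)]|
    = if covers c u && (weight c <= k) then cnt n (k - weight c) c (missed p c) else 0.
  case: ifP => [/andP[-> le_ck]|/negbT nck].
    rewrite -IHn; apply: eq_card => t; rewrite !inE big_cons /=; congr (_ && _); lia.
  apply: eq_card0 => t; rewrite !inE big_cons.
  by apply: contraNF nck => /andP[/andP[-> _] /eqP <-]; rewrite leq_addr.
pose G c := if covers c u && (weight c <= k)
            then cnt n (k - weight c) c (missed p c) else 0.
rewrite (eq_bigr (fun c => G (c.1, c.2))) => [|[a b] _]; last exact: step.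
rewrite -(pair_bigA _ (fun a b => G (a, b))) /= !big_bool /G /=; lia.
Qed.

(** * Dominating sets of the ladder as accepted words *)

Definition col {n : nat} (D : {set 'I_2 * 'I_n}) (i : 'I_n) : bool * bool :=
  ((ord0, i) \in D, (ord_max, i) \in D).

Definition cols {n : nat} (D : {set 'I_2 * 'I_n}) : n.-tuple (bool * bool) :=
  [tuple col D i | i < n].

Lemma I2P (j : 'I_2) : j = ord0 \/ j = ord_max.
Proof. by case: j => [[|[|//]] ?]; [left|right]; apply: val_inj. Qed.

Lemma cols_bij (n : nat) : bijective (@cols n).
Proof.
exists (fun t : n.-tuple (bool * bool) => [set x : 'I_2 * 'I_n |
  if x.1 == ord0 then (tnth t x.2).1 else (tnth t x.2).2]) => [D|t].
  apply/setP => -[j i]; rewrite inE /= tnth_mktuple.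
  by case: (I2P j) => ->.
by apply: eq_from_tnth => i; rewrite tnth_mktuple /col !inE /=; case: (tnth t i).
Qed.

Lemma sum_weight_cols {n : nat} (D : {set 'I_2 * 'I_n}) :
  \sum_(c <- cols D) weight c = #|D|.
Proof.
rewrite big_tuple -sum1_card [RHS]big_mkcond /=.
rewrite [RHS](eq_bigr (fun x => if (x.1, x.2) \in D then 1 else 0)) => [|[] //].
rewrite -(pair_bigA _ (fun j i => if (j, i) \in D then 1 else 0)) /=.
rewrite exchange_big /=; apply: eq_bigr => i _.
rewrite tnth_mktuple big_ord_recl big_ord1 /weight /col /=.
by rewrite (_ : lift ord0 ord0 = ord_max); [do 2 case: ifP | apply: val_inj].
Qed.

Definition dominated_col (p c d : bool * bool) : bool :=
  [|| c.1, c.2, p.1 | d.1] && [|| c.1, c.2, p.2 | d.2].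

(** Unrolls the run into a local condition on three consecutive columns. The default [c0] stands for
    an empty column past the end. *)
Lemma goodP {p u : bool * bool} {s : seq (bool * bool)} :
  let c0 := (false, false) in
  good p u s <-> covers (head c0 s) u /\
    forall i, i < size s ->
      dominated_col (nth c0 (p :: s) i) (nth c0 s i) (nth c0 s i.+1).
Proof.
move=> c0; elim: s p u => [|c s IHs] p u /=.
  by case: u => [[] []]; split=> // -[].
(* What [c] hands on to the next column is met exactly when [c] ends up dominated. *)
have E : covers (head c0 s) (missed p c) = dominated_col p c (head c0 s).
  by rewrite /covers /missed /dominated_col; case: (head _ _) p c => [[] []] [[] []] [[] []].
split.
  case/andP=> -> /IHs[]; rewrite E => h0 h; split=> // -[_|i]; first by rewrite /= nth0.
  exact: h.
case=> -> h; apply/IHs; split; last by move=> i; apply: (h i.+1).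
by rewrite E; have := h 0 isT; rewrite /= nth0.
Qed.

Lemma nth_cols {n : nat} (D : {set 'I_2 * 'I_n}) (i : 'I_n) :
  nth (false, false) (cols D) i = col D i.
Proof. by rewrite -tnth_nth tnth_mktuple. Qed.

Lemma good_cols {n : nat} (D : {set 'I_2 * 'I_n}) :
  good (false, false) (false, false) (cols D)
  = dominating (cart_prod (@path_graph 2) (@path_graph n)) D.
Proof.
pose c0 := (false, false).
pose row (j : 'I_2) (c : bool * bool) := if j == ord0 then c.1 else c.2.
have rowE j i : row j (col D i) = ((j, i) \in D) by case: (I2P j) => ->.
have dcP p c d : reflect (forall j, [|| c.1, c.2, row j p | row j d]) (dominated_col p c d).
  apply: (iffP andP) => [[h0 h1] j|h]; first by case: (I2P j) => ->.
  by split; [have := h ord0 | have := h ord_max].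
apply/idP/idP => [/goodP[_ h]|/forallP h].
  apply/forallP => -[j i]; apply/implyP => vD.
  have ltin : i < size (cols D) by rewrite size_tuple.
  move/dcP: (h i ltin) => /(_ j); rewrite nth_cols.
  case/or4P => H.
  - have {}H : (ord0, i) \in D := H.
    by apply/existsP; exists (ord0, i); rewrite H /cart_prod /= eqxx;
      case: (I2P j) vD H => -> // /negbTE->.
  - have {}H : (ord_max, i) \in D := H.
    by apply/existsP; exists (ord_max, i); rewrite H /cart_prod /= eqxx;
      case: (I2P j) vD H => -> // /negbTE->.
  (* At [i = 0] the previous column is the virtual empty one, so [H] is absurd. *)
  - case: i {vD ltin} H => -[|i] lti /=; first by rewrite /row; case: ifP.
    rewrite (nth_cols D (Ordinal (ltnW lti))) rowE => H.
    by apply/existsP; exists (j, Ordinal (ltnW lti)); rewrite H /cart_prod /path_graph /= !eqxx orbT.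
  have [lti|gei] := ltnP i.+1 n; last first.
    by move: H; rewrite nth_default ?size_tuple // /row; case: ifP.
  move: H; rewrite (nth_cols D (Ordinal lti)) rowE => H.
  by apply/existsP; exists (j, Ordinal lti); rewrite H /cart_prod /path_graph /= !eqxx.
apply/goodP; split=> // i; rewrite size_tuple => ltin.
apply/dcP => j; move: (Ordinal ltin) (erefl : nat_of_ord (Ordinal ltin) = i) => {ltin} o <-.
rewrite nth_cols; move: (h (j, o)); rewrite implyNb => /orP[|].
  by rewrite /col; case: (I2P j) => -> /= ->; rewrite ?orbT.
case/existsP => -[j' i'] /andP[vD]; rewrite /cart_prod /path_graph /=.
case/orP => [/andP[/eqP-> /orP[/eqP E|/eqP E]]|/andP[/eqP E _]].
- by rewrite E nth_cols rowE vD !orbT.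
- by rewrite -E /= nth_cols rowE vD !orbT.
by rewrite E /col /=; case: (I2P j') vD => -> ->; rewrite ?orbT.
Qed.

Lemma card_dominating (n k : nat) :
  #|[set D | dominating (cart_prod (@path_graph 2) (@path_graph n)) D && (#|D| == k)]|
  = cnt n k (false, false) (false, false).
Proof.
rewrite -card_good -(on_card_preimset (onW_bij _ (cols_bij n))).
by apply: eq_card => D; rewrite !inE good_cols sum_weight_cols.
Qed.

(** The hypotheses make [g] the domination number, so the minimum dominating sets are those of size
    [g]. *)
Lemma tau_cnt (n g : nat) :
    (forall k, k < g -> cnt n k (false, false) (false, false) = 0) ->
    0 < cnt n g (false, false) (false, false) ->
  tau (cart_prod (@path_graph 2) (@path_graph n))
  = cnt n g (false, false) (false, false).
Proof.
move=> small; rewrite -card_dominating.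
case/card_gt0P => D0; rewrite inE => /andP[domD0 /eqP cD0].
have minD D : dominating (cart_prod (@path_graph 2) (@path_graph n)) D -> g <= #|D|.
  move=> domD; rewrite leqNgt; apply/negP => /small.
  rewrite -card_dominating => /eqP; rewrite cards_eq0 => /eqP/setP/(_ D).
  by rewrite !inE domD eqxx.
apply: eq_card => D; rewrite !inE /min_dominating.
case domD: (dominating _ D) => //=.
apply/forallP/eqP => [/(_ D0)|cD D']; last by apply/implyP => /minD; rewrite cD.
by rewrite domD0 /= cD0 => leD; apply/eqP; rewrite eqn_leq leD minD.
Qed.

(** * Row symmetry and the recurrence on five states *)

Definition swap (c : bool * bool) : bool * bool := (c.2, c.1).

Lemma cnt_swap (n k : nat) (p u : bool * bool) :
  cnt n k (swap p) (swap u) = cnt n k p u.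
Proof.
elim: n k p u => [|n IHn] k p u; first by case: u => [[] []].
case: p u => [p1 p2] [u1 u2] /=.
have IH a b c d j : cnt n j (b, a) (d, c) = cnt n j (a, b) (c, d).
  by rewrite -IHn.
by case: p1 p2 u1 u2 => [] [] [] [];
  rewrite ?(IH true false) ?(IH false false true false) //; lia.
Qed.

(** The three empty-column states differ in how many of its vertices wait for the next column;
    [Empty] is also the initial state. *)
Notation Full n k := (cnt n k (true, true) (false, false)).
Notation Half n k := (cnt n k (true, false) (false, false)).
Notation Empty n k := (cnt n k (false, false) (false, false)).
Notation HalfMissed n k := (cnt n k (false, false) (false, true)).
Notation Missed n k := (cnt n k (false, false) (true, true)).

(** The factor 2 counts the two one-vertex columns, equivalent by [cnt_swap]. An empty column may
    follow only when nothing is marked; what it leaves marked depends on the previous column. *)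
Lemma cntS (n k : nat) :
  let F := if 2 <= k then Full n (k - 2) else 0 in
  let H := if 1 <= k then Half n (k - 1) else 0 in
  [/\ Full n.+1 k = F + 2 * H + Empty n k,
      Half n.+1 k = F + 2 * H + HalfMissed n k,
      Empty n.+1 k = F + 2 * H + Missed n k,
      HalfMissed n.+1 k = F + H
    & Missed n.+1 k = F].
Proof.
have E j : cnt n j (false, true) (false, false) = Half n j by rewrite -cnt_swap.
have w1 : weight (true, false) = 1 by [].
have w1' : weight (false, true) = 1 by [].
have w2 : weight (true, true) = 2 by [].
move=> F H; split; rewrite /= /missed /= ?E ?w1 ?w1' ?w2 ?subn0 /F /H;
  do ?[case: ifP => ?]; lia.
Qed.

(** * Vanishing below the threshold, and closed forms at it *)

(** Each transition of [cntS] preserves these thresholds. The induction starts at length 2 because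
    [Full 1 0] is 1. *)
Lemma cnt_small {n : nat} (k : nat) :
  2 <= n ->
  [/\ 2 * k < n -> Full n k = 0, 2 * k < n -> Half n k = 0,
      2 * k < n.+1 -> Empty n k = 0, 2 * k < n.+1 -> HalfMissed n k = 0
    & 2 * k < n.+2 -> Missed n k = 0].
Proof.
case: n => [|[|n]] // _.
elim: n k => [|n IHn] k; first by case: k => [|[|k]]; split=> //; lia.
have [-> -> -> -> ->] := cntS n.+2 k.
have [F H E P W] := IHn k; have [_ H1 _ _ _] := IHn (k - 1); have [F2 _ _ _ _] := IHn (k - 2).
by case: k => [|[|k]] /= in F H E P W H1 F2 *; split; lia.
Qed.

(** Each weight is the least one left open by [cnt_small]. Where that bound is tight the count is
    constant; the linear counts have slack one in [2 * k]. *)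
Lemma cnt_min {m : nat} :
  4 <= m ->
  [/\ Full m.*2 m = 2, Half m.*2 m = 1, Empty m.*2 m.+1 = 4 * m + 4
    & HalfMissed m.*2 m.+1 = 2 * m + 1]
  /\ Empty m.*2.+1 m.+1 = 2.
Proof.
have odd_step k : 4 <= k ->
    [/\ Full k.*2 k = 2, Half k.*2 k = 1 & HalfMissed k.*2 k.+1 = 2 * k + 1] ->
    [/\ Half k.*2.+1 k.+1 = 2 * k + 3, Empty k.*2.+1 k.+1 = 2,
        HalfMissed k.*2.+1 k.+1 = 1 & Missed k.*2.+1 k.+2 = 2].
  move=> le4k [F H P].
  have [|F0 _ _ _ _] := @cnt_small k.*2 (k - 1); first lia.
  (* This weight lies exactly at the threshold of [Missed]; after the forced full column it falls
     below that of [Full]. *)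
  have W0 : Missed k.*2 k.+1 = 0.
    rewrite (_ : k.*2 = (k.*2 - 1).+1); last lia.
    have [_ _ _ _ ->] := cntS (k.*2 - 1) k.+1.
    have [|-> //] := @cnt_small (k.*2 - 1) (k.+1 - 2); first lia; last lia.
    by case: ifP.
  have [_ -> -> -> _] := cntS k.*2 k.+1; have [_ _ _ _ ->] := cntS k.*2 k.+2.
  rewrite (_ : k.+1 - 2 = k - 1) ?subSS ?subn0; last lia.
  have k1 : 1 < k.+1 by lia.
  by rewrite F H P W0 k1 F0 /=; try split; lia.
have even_case : 4 <= m -> [/\ Full m.*2 m = 2, Half m.*2 m = 1,
    Empty m.*2 m.+1 = 4 * m + 4 & HalfMissed m.*2 m.+1 = 2 * m + 1]; last first.
  move=> le4m; have [F H E P] := even_case le4m.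
  by have [_ O _ _] := odd_step m le4m (And3 F H P).
elim: m => [|k IHk] // le3k.
have [->|le4k] : k = 3 \/ 4 <= k by lia.
  (* The base is length 8: at length 6 the count is 17, not 16. *)
  by vm_compute.
have [F H E P] := IHk le4k; have [H' E' P' W'] := odd_step k le4k (And3 F H P).
have [|F0 H0 _ _ _] := @cnt_small k.*2.+1 k; first lia.
have [|F1 _ _ _ _] := @cnt_small k.*2.+1 (k - 1); first lia.
rewrite doubleS.
have [-> -> _ _ _] := cntS k.*2.+1 k.+1; have [_ _ -> -> _] := cntS k.*2.+1 k.+2.
rewrite (_ : k.+1 - 2 = k - 1) ?subSS ?subn0; last lia.
have k1 : 1 < k.+1 by lia.
rewrite E' P' W' H' k1 ?F0 ?H0 ?F1 //=; try lia.
by split; lia.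
Qed.

Lemma cnt_lt8 :
  [/\ Empty 2 2 = 6, Empty 3 2 = 3, Empty 4 3 = 12, Empty 5 3 = 2
    & Empty 6 4 = 17 /\ Empty 7 4 = 2].
Proof. by vm_compute. Qed.

Theorem theorem3p4 (n : nat) (hn : 2 <= n) :
  let t := tau (cart_prod (@path_graph 2) (@path_graph n)) in
  [/\ n = 2 -> t = 6,
      n = 3 -> t = 3,
      n = 6 -> t = 17,
      odd n /\ n <> 3 -> t = 2
    & ~~ odd n /\ n <> 2 /\ n <> 6 -> t = 2 * n + 4].
Proof.
move=> t.
(* [n./2.+1] is the domination number: [cnt_small] excludes smaller sets, and positivity is read off
   the values found. *)
suff tE : 0 < Empty n n./2.+1 -> t = Empty n n./2.+1.
  have [lt8n|le8n] := ltnP n 8.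
    have [E2 E3 E4 E5 [E6 E7]] := cnt_lt8.
    have : n \in [:: 2; 3; 4; 5; 6; 7] by rewrite !inE; lia.
    rewrite !inE => n_cases; move: tE; clearbody t; move: n_cases.
    by case/or4P => [/eqP->|/eqP->|/eqP->|/or3P[]/eqP->];
      rewrite [_./2.+1]/= ?E2 ?E3 ?E4 ?E5 ?E6 ?E7 => /(_ isT) ->; split=> //; lia.
  have le4m : 4 <= n./2 by lia.
  have := odd_double_half n; move: (n./2) le4m tE => m le4m tE nE; clearbody t.
  have [[_ _ E _] O] := cnt_min le4m.
  split; try lia; case=> [odd_n _].
    by rewrite (_ : n = m.*2.+1) ?O in tE; [exact: tE | lia].
  have n_even : n = m.*2 by lia.
  by rewrite n_even E in tE; rewrite n_even tE; lia.
apply: tau_cnt => k ltk.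
by have [_ _ -> //] := cnt_small k hn; lia.
Qed.
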